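(* Let $\sigma\le\tau$ in the consecutive pattern poset $S$, let $n=|\tau|-|\sigma|$, and let $C:\tau=\rho_0\to\rho_1\to\cdots\to\rho_n=\sigma$ be a maximal chain of $[\sigma,\tau]$ with chain id $l_1\ldots l_n$. For $0\le i<j\le n$, the interval $C(\rho_i,\rho_j)$ is a minimal skipped interval of $C$ (with respect to the lexicographic order of chain ids on the maximal chains of $[\sigma,\tau]$) if and only if either (a) $C(\rho_i,\rho_j)=\{\rho_{i+1}\}$ (i.e. $j=i+2$) and $\rho_{i+1}$ is a strong descent, or (b) $\rho_j=x(\rho_i)$, $x(\rho_i)\not\le i(\rho_i)$, and the sequence $l_{i+1},\ldots,l_j$ is decreasing (where a sequence consisting of a single label is not considered decreasing).
   Context: For $d\ge1$, $S_d$ is the set of permutations of $\{1,\dots,d\}$ in one-line notation, $S=\bigcup_{d>0}S_d$, and $|\tau|=d$ for $\tau\in S_d$. The standard form of a sequence of distinct integers $s(1)\ldots s(k)$ is the permutation in $S_k$ whose entries are in the same relative order. The consecutive pattern poset orders $S$ by $\sigma\le\tau$ ($\sigma\in S_k$, $\tau\in S_d$) iff for some $i$ the standard form of $\tau(i+1)\ldots\tau(i+k)$ equals $\sigma$. A permutation is monotone if its entries are strictly increasing or strictly decreasing. A prefix (resp. suffix) of length $k$ of $\rho\in S_d$ is the standard form of its first (resp. last) $k$ letters; it is proper if $k<d$. For $d>2$ the interior $i(\rho)$ is the standard form of $\rho(2)\ldots\rho(d-1)$. The exterior $x(\rho)$ is the longest permutation which is both a proper prefix and a suffix of $\rho$.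 In a maximal chain $\tau=\rho_0\to\cdots\to\rho_n=\sigma$ ($\to$ denotes a cover, $|\rho_i|=|\tau|-i$), the chain id $l_1\ldots l_n$ is defined inductively by windows of positions of $\tau$: $W_0=\{1,\dots,|\tau|\}$; given $W_{i-1}=\{a,\dots,b\}$ with the standard form of $\tau(a)\ldots\tau(b)$ equal to $\rho_{i-1}$: if $\rho_{i-1}$ is not monotone, exactly one of the standard forms of $\tau(a+1)\ldots\tau(b)$ and $\tau(a)\ldots\tau(b-1)$ equals $\rho_i$; in the first case put $l_i=a$, $W_i=\{a+1,\dots,b\}$, in the second $l_i=b$, $W_i=\{a,\dots,b-1\}$; if $\rho_{i-1}$ is monotone put $l_i=a$, $W_i=\{a+1,\dots,b\}$. Maximal chains of $[\sigma,\tau]$ are totally ordered by the lexicographic order of their chain ids. For $0\le i<j\le n$, $C(\rho_i,\rho_j)=\{\rho_{i+1},\dots,\rho_{j-1}\}$. A nonempty $C(\rho_i,\rho_j)$ is a skipped interval of $C$ if the set of elements of $C$ not in $C(\rho_i,\rho_j)$ is contained in some maximal chain $C'$ of $[\sigma,\tau]$ lexicographically earlier than $C$; it is a minimal skipped interval if it properly contains no other skipped interval of $C$. For $1\le k\le n-1$, $\rho_k$ is a strong descent if $l_k>l_{k+1}+1$. *)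

(* Defs.v *)
From mathcomp Require Import all_boot all_order.

Set Implicit Arguments.
Unset Strict Implicit.
Unset Printing Implicit Defensive.

(* A permutation of {1, ..., d} is its one-line notation, a sequence of nats;
   the empty sequence is not a permutation since d >= 1. *)
Definition oneline (s : seq nat) : bool :=
  (0 < size s) && perm_eq s (iota 1 (size s)).

(* Standard form: each letter is replaced by its rank (counted from 1).
   Meaningful for sequences of distinct letters. *)
Definition std (s : seq nat) : seq nat :=
  [seq count (fun y => y <= x) s | x <- s].

Definition cp_le (sigma tau : seq nat) : Prop :=
  exists2 i, i + size sigma <= size tau
           & std (take (size sigma) (drop i tau)) = sigma.

Definition cp_cover (tau sigma : seq nat) : Prop :=
  [/\ cp_le sigma tau, sigma <> tau
    & forall rho, oneline rho -> cp_le sigma rho -> cp_le rho tau ->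
        rho = sigma \/ rho = tau].

Definition monotone (s : seq nat) : bool := sorted ltn s || sorted gtn s.

Definition perm_prefix (k : nat) (r : seq nat) : seq nat := std (take k r).

Definition perm_suffix (k : nat) (r : seq nat) : seq nat :=
  std (drop (size r - k) r).

(* Only meaningful when 2 < size r. *)
Definition interior (r : seq nat) : seq nat := std (behead (take (size r).-1 r)).

(* Only meaningful when 1 < size r: then k = 1 is always a candidate.
   For size r = 1 there is no proper prefix and the value is [::]. *)
Definition exterior (r : seq nat) : seq nat :=
  perm_prefix (\max_(k < size r | perm_prefix k r == perm_suffix k r) k) r.

(* C = [:: rho_0; ...; rho_n] with rho_0 = tau and rho_n = sigma *)
Definition maximal_chain (sigma tau : seq nat) (C : seq (seq nat)) : Prop :=
  [/\ 0 < size C, head [::] C = tau, last [::] C = sigma,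
      all oneline C
    & forall i, i.+1 < size C -> cp_cover (nth [::] C i) (nth [::] C i.+1)].

(* std (tau(a) ... tau(b)), positions counted from 1 *)
Definition window (tau : seq nat) (a b : nat) : seq nat :=
  std (drop a.-1 (take b tau)).

(* Labels of the chain rho :: rest, where rho sits at the positions a, ..., b
   of tau.  When rho is not monotone, exactly one of window tau a.+1 b and
   window tau a b.-1 is the next element of the chain. *)
Fixpoint chain_labels (tau : seq nat) (a b : nat) (rho : seq nat)
    (rest : seq (seq nat)) : seq nat :=
  if rest is rho' :: rest' then
    if monotone rho || (window tau a.+1 b == rho')
    then a :: chain_labels tau a.+1 b rho' rest'
    else b :: chain_labels tau a b.-1 rho' rest'
  else [::].

Definition chain_id (C : seq (seq nat)) : seq nat :=
  if C is tau :: rest then chain_labels tau 1 (size tau) tau rest else [::].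

(* l_k, for 1 <= k <= n *)
Definition label (C : seq (seq nat)) (k : nat) : nat :=
  nth 0 (chain_id C) k.-1.

Definition chain_lex_lt (C' C : seq (seq nat)) : bool :=
  ((chain_id C' : seqlexi nat) < (chain_id C : seqlexi nat))%O.

(* C(rho_i, rho_j) = {rho_(i+1), ..., rho_(j-1)} *)
Definition chain_interval (C : seq (seq nat)) (i j : nat) : seq (seq nat) :=
  [seq nth [::] C k | k <- iota i.+1 (j - i.+1)].

Definition skipped_interval (sigma tau : seq nat) (C : seq (seq nat))
    (i j : nat) : Prop :=
  [/\ i < j < size C, chain_interval C i j <> [::]
    & exists C', [/\ maximal_chain sigma tau C', chain_lex_lt C' C
        & forall r, r \in C -> r \notin chain_interval C i j -> r \in C']].

Definition minimal_skipped_interval (sigma tau : seq nat) (C : seq (seq nat))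
    (i j : nat) : Prop :=
  skipped_interval sigma tau C i j /\
  forall i' j', skipped_interval sigma tau C i' j' ->
    {subset chain_interval C i' j' <= chain_interval C i j} ->
    chain_interval C i' j' =i chain_interval C i j.

(* The range 1 <= k <= n - 1, where n = size (chain_id C). *)
Definition strong_descent (C : seq (seq nat)) (k : nat) : bool :=
  (1 <= k < size (chain_id C)) && ((label C k.+1).+1 < label C k).

(* l_(i+1), ..., l_j is decreasing; a single label does not count. *)
Definition labels_decreasing (C : seq (seq nat)) (i j : nat) : bool :=
  (i.+1 < j) && sorted gtn [seq label C k | k <- iota i.+1 (j - i)].

(* Main.v *)
Require Import Defs.
From mathcomp Require Import all_boot all_order.
From mathcomp Require Import zify.

Set Implicit Arguments.
Unset Strict Implicit.
Unset Printing Implicit Defensive.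

(* At each step a chain shrinks its window [a, b] from the left (label a) or
   from the right (label b), and it shrinks from the left when the pattern is
   monotone.  A lexicographically earlier chain must first deviate by going left
   where C goes right.  Hence C(rho_i, rho_j) is skipped iff for some k >= i, with
   k + 1 < j, C goes right at rho_k and rho_j still occurs in rho_k stripped of its
   first letter; such a pair (k, j) is called a detour, and minimal skipped
   intervals are the minimal detours.  A right move followed by a left move is
   a strong descent, and is a detour by itself.  Otherwise a minimal detour has
   right moves only, so rho_j is a prefix of rho_i; minimality forces rho_j to
   occur in rho_i, besides as a prefix, only as a suffix, and forces this
   prefix to be the exterior. *)

(** * Standard forms and factors of words *)

Definition factor (s : seq nat) (p k : nat) : seq nat := std (take k (drop p s)).

Lemma size_std s : size (std s) = size s.
Proof. by rewrite size_map. Qed.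

(** When [y < x], the letter [x] itself is counted on the left and not on the right, so the ranks
    compare strictly. *)
Lemma leq_count_leq (s : seq nat) (x y : nat) : x \in s -> 
  (count (fun z => z <= x) s <= count (fun z => z <= y) s) = (x <= y).
Proof.
move=> xs; apply/idP/idP => [|lexy].
  apply: contraTT; rewrite -!ltnNge => ltyx.
  rewrite (_ : count (fun z => z <= x) s =
    count (fun z => z <= y) s + count (fun z => y < z <= x) s).
    by rewrite -addn1 leq_add2l -has_count; apply/hasP; exists x; rewrite ?ltyx /=.
  rewrite -count_predUI (eq_count (a2 := pred0) (a1 := predI _ _)); last by move=> z /=; lia.
  by rewrite count_pred0 addn0; apply: eq_count => z /=; lia.
by apply: sub_count => z /= /leq_trans; apply.
Qed.

Lemma leq_nth_std s i j : i < size s -> j < size s ->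
  (nth 0 (std s) i <= nth 0 (std s) j) = (nth 0 s i <= nth 0 s j).
Proof.
by move=> lti ltj; rewrite !(nth_map 0) // leq_count_leq // mem_nth.
Qed.

Lemma count_nth (P : pred nat) s :
  count P s = count (fun i => P (nth 0 s i)) (iota 0 (size s)).
Proof. by rewrite -{1}(mkseq_nth 0 s) count_map. Qed.

Lemma eq_std s t : size s = size t ->
  (forall i j, i < size s -> j < size s ->
     (nth 0 s i <= nth 0 s j) = (nth 0 t i <= nth 0 t j)) ->
  std s = std t.
Proof.
move=> eqst eqle; apply: (@eq_from_nth _ 0); rewrite !size_std // => i lti.
rewrite !(nth_map 0) -?eqst // !(count_nth _ s) !(count_nth _ t) -eqst.
by apply: eq_in_count => j; rewrite mem_iota => /andP[_ ltj]; apply: eqle.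
Qed.

Lemma nth_take_drop s p k i : i < k -> nth 0 (take k (drop p s)) i = nth 0 s (p + i).
Proof. by move=> lti; rewrite nth_take // nth_drop. Qed.

Lemma size_take_drop (s : seq nat) p k : p + k <= size s -> size (take k (drop p s)) = k.
Proof. by move=> le; rewrite size_takel // size_drop; lia. Qed.

Lemma size_factor s p k : p + k <= size s -> size (factor s p k) = k.
Proof. by move=> le; rewrite size_std size_take_drop. Qed.

(** Standardizing keeps all comparisons between positions, so doing it first on the larger factor
    does not affect the inner one. *)
Lemma factor_factor s p k q l : p + k <= size s -> q + l <= k ->
  factor (factor s p k) q l = factor s (p + q) l.
Proof.
move=> lepk leql; have sz := size_factor lepk.
apply: eq_std => [|i j]; rewrite !size_take_drop ?sz //; try lia.
move=> lti ltj; rewrite !nth_take_drop // leq_nth_std ?size_take_drop //; try lia.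
rewrite !nth_take_drop ?addnA //; lia.
Qed.

Lemma std_oneline s : oneline s -> std s = s.
Proof.
case/andP=> _ ps; apply: map_id_in => x; rewrite (perm_mem ps) mem_iota => /andP[x0 xs].
(* The letters are 1, ..., d; splitting this list after [x] leaves exactly [x] counted letters. *)
have -> : count (fun y => y <= x) s = count (fun y => y <= x) (iota 1 (x + (size s - x))).
  by rewrite (permP ps); congr (count _ (iota 1 _)); lia.
rewrite iotaD count_cat.
rewrite (@eq_in_count _ _ predT); last by move=> y; rewrite mem_iota /=; lia.
rewrite count_predT size_iota (@eq_in_count _ _ pred0) ?count_pred0 ?addn0 //.
by move=> y; rewrite mem_iota /=; lia.
Qed.

Lemma oneline_uniq s : oneline s -> uniq s.
Proof. by case/andP=> _ /perm_uniq->; apply: iota_uniq. Qed.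

Lemma oneline_gt0 s : oneline s -> 0 < size s.
Proof. by case/andP. Qed.

Lemma oneline_std (s : seq nat) : 0 < size s -> uniq s -> oneline (std s).
Proof.
move=> s0 us; rewrite /oneline size_std s0 /=.
have ustd : uniq (std s).
  rewrite map_inj_in_uniq // => x y xs ys eqxy; apply/eqP.
  by rewrite eqn_leq -(leq_count_leq y xs) -(leq_count_leq x ys) eqxy leqnn.
apply: uniq_perm => //; first exact: iota_uniq.
apply: (uniq_min_size ustd _ _).2; last by rewrite size_iota size_std.
move=> _ /mapP[x xs ->]; rewrite mem_iota add1n ltnS count_size andbT.
by rewrite -has_count; apply/hasP; exists x.
Qed.

Lemma oneline_factor (s : seq nat) p k :
  uniq s -> 0 < k -> p + k <= size s -> oneline (factor s p k).
Proof.
move=> us k0 le; apply: oneline_std; first by rewrite size_take_drop.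
by rewrite take_uniq // drop_uniq.
Qed.

Lemma factor_oneline s : oneline s -> factor s 0 (size s) = s.
Proof. by move=> os; rewrite /factor drop0 take_size std_oneline. Qed.

Lemma cp_le_factor s tau p k : p + k <= size tau ->
  cp_le s (factor tau p k) <->
  exists q, [/\ p <= q, q + size s <= p + k & factor tau q (size s) = s].
Proof.
move=> le; split=> [[q]|[q [lepq leq eqs]]].
  rewrite size_factor // => leq eqs; exists (p + q).
  by split; [lia | lia | rewrite -(@factor_factor _ _ k)].
exists (q - p); first by rewrite size_factor //; lia.
rewrite -/(factor _ _ _) factor_factor ?subnKC //; lia.
Qed.

Lemma cp_le_factorI tau p k q l : p <= q -> q + l <= p + k -> p + k <= size tau ->
  cp_le (factor tau q l) (factor tau p k).
Proof.
move=> lepq leq le; apply/cp_le_factor => //; exists q.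
by rewrite (@size_factor _ q l); [split | lia].
Qed.

Lemma cp_le_size s t : cp_le s t -> size s <= size t.
Proof. by case=> q le _; lia. Qed.

Lemma cp_le_trans r s t : cp_le r s -> cp_le s t -> cp_le r t.
Proof.
move=> [p lep eqr] [q leq eqs]; exists (q + p); first lia.
rewrite -{2}eqr -eqs -!/(factor _ _ _) factor_factor // size_std // size_take_drop.
Qed.

Lemma cp_le_eq s t : oneline t -> size s = size t -> cp_le s t -> s = t.
Proof.
move=> ot eqst [q le]; rewrite -/(factor _ _ _) => <-.
rewrite (_ : q = 0) ?eqst ?factor_oneline //; lia.
Qed.

Lemma cp_coverI s t : oneline s -> oneline t -> cp_le s t ->
  size t = (size s).+1 -> cp_cover t s.
Proof.
move=> os ot les sz; split=> // [eqst|r or lesr lert].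
  by move: sz; rewrite eqst; lia.
have := cp_le_size lesr; have := cp_le_size lert.
rewrite sz leq_eqVlt => /orP[/eqP eqr _|ltr ler]; [right|left].
  by apply: cp_le_eq; rewrite ?sz.
by apply/esym/cp_le_eq => //; lia.
Qed.

Lemma cp_cover_size s t : oneline s -> oneline t -> cp_cover t s ->
  size t = (size s).+1.
Proof.
move=> os ot [les neqst cov].
have [q le eqs] := les; rewrite -/(factor _ _ _) in eqs.
have s0 := oneline_gt0 os.
have lts : size s < size t.
  rewrite ltn_neqAle cp_le_size // andbT; apply/eqP => sz.
  exact/neqst/cp_le_eq.
(* An occurrence of [s] lies in a window one letter longer, which must be all of [t]. *)
pose p := minn q (size t - (size s).+1).
have lep : p + (size s).+1 <= size t by lia.
have := cov (factor t p (size s).+1).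
case=> [|||eqf|eqf].
- by apply: oneline_factor => //; apply: oneline_uniq.
- by rewrite -{1}eqs; apply: cp_le_factorI => //; lia.
- by rewrite -{2}(factor_oneline ot); apply: cp_le_factorI; lia.
- by move: (congr1 size eqf); rewrite size_factor //; lia.
- by move: (congr1 size eqf); rewrite size_factor.
Qed.

(** If shifting by one position preserves all comparisons, every comparison of neighbours agrees
    with the first one. Hence the two end deletions of a pattern differ unless it is monotone. *)
Lemma monotone_factor (s : seq nat) : uniq s ->
  monotone s = (factor s 0 (size s).-1 == factor s 1 (size s).-1).
Proof.
move=> us; case sz: (size s) => [|n] /=; first by rewrite (size0nil sz).
have sz0 : size (take n (drop 0 s)) = n by rewrite size_take_drop ?sz.
have sz1 : size (take n (drop 1 s)) = n by rewrite size_take_drop ?sz.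
apply/idP/eqP => [|eqf].
  move=> mon; apply: eq_std; rewrite sz0 ?sz1 // => i j lti ltj.
  rewrite !nth_take_drop //.
  case/orP: mon => [inc|dec].
    have lt_nth u v : u < v -> v <= n -> nth 0 s u < nth 0 s v.
      by move=> ltuv lev; apply: (sorted_ltn_nth ltn_trans 0 inc); rewrite ?unfold_in /= ?sz; lia.
    have := lt_nth i j; have := lt_nth i.+1 j.+1.
    have := lt_nth j i; have := lt_nth j.+1 i.+1.
    by case: (ltngtP i j) => [||->]; rewrite ?add0n ?add1n; lia.
  have gt_nth u v : u < v -> v <= n -> nth 0 s v < nth 0 s u.
    by move=> ltuv lev; apply: (sorted_ltn_nth (leT := gtn) _ 0 dec) => [? ? ? ? ?|||];
      rewrite ?unfold_in /= ?sz; lia.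
  have := gt_nth i j; have := gt_nth i.+1 j.+1.
  have := gt_nth j i; have := gt_nth j.+1 i.+1.
  by case: (ltngtP i j) => [||->]; rewrite ?add0n ?add1n; lia.
have eqle i j : i < n -> j < n ->
  (nth 0 s i <= nth 0 s j) = (nth 0 s i.+1 <= nth 0 s j.+1).
  move=> lti ltj; have := leq_nth_std (s := take n (drop 0 s)) (i := i) (j := j).
  rewrite -/(factor _ _ _) eqf sz0 leq_nth_std ?sz1 // !nth_take_drop //.
  by move=> ->.
have up i : i < n -> (nth 0 s i <= nth 0 s i.+1) = (nth 0 s 0 <= nth 0 s 1).
  by elim: i => // i IHi lti; rewrite -eqle // ?IHi //; lia.
apply/orP; case: (leqP (nth 0 s 0) (nth 0 s 1)) => le01; [left|right].
  apply/(sortedP 0) => i; rewrite sz => lti; rewrite /= ltn_neqAle up // le01 andbT.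
  by rewrite nth_uniq ?sz //; lia.
by apply/(sortedP 0) => i; rewrite sz => lti; rewrite /= ltnNge up // -ltnNge.
Qed.

(** * Windows, moves and labels *)

Lemma window_factor tau a b : window tau a.+1 b = factor tau a (b - a).
Proof.
rewrite /window /factor /=; case: (leqP a b) => [leab|ltba].
  by rewrite take_drop subnK.
rewrite (eqP (ltnW ltba : b - a == 0)) take0 drop_oversize //.
by rewrite size_take_min; lia.
Qed.

Lemma seqlexi_lt_nth (s t : seq nat) k : k < size s -> k < size t ->
  take k s = take k t -> nth 0 s k != nth 0 t k ->
  ((s : seqlexi nat) < (t : seqlexi nat))%O = (nth 0 s k < nth 0 t k).
Proof.
elim: k s t => [|k IHk] [|x s] [|y t] //= lts ltt.
  by move=> _ neq; rewrite ltxi_cons !leEnat; lia.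
by case=> -> eqt neq; rewrite ltxi_cons Order.POrderTheory.lexx /= IHk.
Qed.

(* Zero-based start of the window of [tau] occupied by the [k]-th element of [C]. *)
Fixpoint offset (tau : seq nat) (C : seq (seq nat)) (k : nat) : nat :=
  if k is k'.+1 then
    offset tau C k' + (monotone (nth [::] C k')
      || (factor tau (offset tau C k').+1 (size tau - k) == nth [::] C k))
  else 0.

(** Monotone patterns count as left moves, following the convention of chain ids. The test is the
    increment in [offset]. *)
Definition left_move (tau : seq nat) (C : seq (seq nat)) (k : nat) : bool :=
  monotone (nth [::] C k)
  || (factor tau (offset tau C k).+1 (size tau - k.+1) == nth [::] C k.+1).

(** The deleted end of the window, whose positions in [tau], counted from 1, are [offset + 1] to
    [offset + (size tau - k)]. *)
Definition move_label (tau : seq nat) (C : seq (seq nat)) (k : nat) : nat :=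
  if left_move tau C k then (offset tau C k).+1
  else offset tau C k + (size tau - k).

Lemma offsetS tau C k : offset tau C k.+1 = offset tau C k + left_move tau C k.
Proof. by []. Qed.

Lemma chain_labelsE tau C k m : k + m = (size C).-1 -> size C <= size tau ->
  0 < size C ->
  chain_labels tau (offset tau C k).+1 (offset tau C k + (size tau - k))
    (nth [::] C k) (drop k.+1 C) = [seq move_label tau C j | j <- iota k m].
Proof.
move=> eqm leC C0; elim: m k eqm => [|m IHm] k eqm.
  by rewrite drop_oversize //; lia.
have ltk : k.+1 < size C by lia.
rewrite (drop_nth [::] ltk) [LHS]/= window_factor.
have -> : offset tau C k + (size tau - k) - (offset tau C k).+1 = size tau - k.+1 by lia.
rewrite -/(left_move tau C k) /= {1}/move_label.
have := IHm k.+1; rewrite addSnnS => /(_ eqm); rewrite offsetS.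
case: (left_move tau C k) => <-.
  by rewrite addn1; congr (_ :: chain_labels _ _ _ _ _); lia.
by rewrite addn0; congr (_ :: chain_labels _ _ _ _ _); lia.
Qed.

Lemma offset_eq tau C C' k : (forall m, m <= k -> nth [::] C m = nth [::] C' m) ->
  offset tau C k = offset tau C' k.
Proof.
elim: k => //= k IHk eqC.
by rewrite IHk => [|m lem]; rewrite ?eqC //; lia.
Qed.

(** * Positions and labels along one maximal chain *)

Section Chain.

Variables (sigma tau : seq nat) (C : seq (seq nat)).
Hypothesis maxC : maximal_chain sigma tau C.

Lemma chain_oneline k : k < size C -> oneline (nth [::] C k).
Proof. by case: maxC => _ _ _ /all_nthP onC _; apply: onC. Qed.

Lemma chain_head : nth [::] C 0 = tau.
Proof. by case: maxC => _ <- _ _ _; rewrite nth0. Qed.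

Lemma chain_last : nth [::] C (size C).-1 = sigma.
Proof. by case: maxC => _ _ <- _ _; rewrite nth_last. Qed.

Lemma chain_gt0 : 0 < size C.
Proof. by case: maxC. Qed.

Lemma chain_top_oneline : oneline tau.
Proof. by rewrite -chain_head chain_oneline // chain_gt0. Qed.

Lemma chain_size_nth k : k < size C -> size (nth [::] C k) + k = size tau.
Proof.
elim: k => [|k IHk] ltk; first by rewrite chain_head addn0.
rewrite -IHk 1?ltnW // (@cp_cover_size (nth [::] C k.+1) (nth [::] C k)) ?addSnnS //.
- exact: chain_oneline.
- by apply: chain_oneline; apply: ltnW.
by case: maxC => _ _ _ _; apply.
Qed.

Lemma chain_nth_size k : k < size C -> size (nth [::] C k) = size tau - k.
Proof. by move=> ltk; rewrite -(chain_size_nth ltk) addnK. Qed.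

Lemma chain_index_lt k : k < size C -> k < size tau.
Proof.
move=> ltk; have := chain_size_nth ltk; have := oneline_gt0 (chain_oneline ltk); lia.
Qed.

Lemma chain_size : size C = (size tau - size sigma).+1.
Proof.
have C0 := chain_gt0.
have lt : (size C).-1 < size C by lia.
have := chain_size_nth lt; rewrite chain_last; lia.
Qed.

Lemma chain_size_le : size C <= size tau.
Proof.
have C0 := chain_gt0.
have lt : (size C).-1 < size C by lia.
by have := chain_index_lt lt; lia.
Qed.

Lemma chain_le k m : k <= m -> m < size C ->
  cp_le (nth [::] C m) (nth [::] C k).
Proof.
elim: m => [|m IHm]; rewrite leq_eqVlt => /orP[/eqP->|] //.
1,2: move=> lt; have := chain_oneline lt => on; exists 0; rewrite ?add0n //; exact: factor_oneline.
rewrite ltnS => lekm ltm; apply: (@cp_le_trans _ (nth [::] C m)).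
  by case: maxC => _ _ _ _ /(_ _ ltm) [].
by apply: IHm => //; apply: ltnW.
Qed.

(** Correctness of [offset]: a cover deletes an end letter, so a failed test for the left deletion
    leaves only the right one. *)
Lemma chain_factor k : k < size C ->
  nth [::] C k = factor tau (offset tau C k) (size tau - k) /\ offset tau C k <= k.
Proof.
elim: k => [|k IHk] ltk.
  by rewrite chain_head subn0 factor_oneline //; apply: chain_top_oneline.
have [eqk lek] := IHk (ltnW ltk).
have ltN := chain_index_lt ltk.
have sz := chain_nth_size ltk.
have : cp_le (nth [::] C k.+1) (nth [::] C k) by apply: chain_le.
(* [rho_(k+1)] is one letter shorter than [rho_k], so its position [q] has two possible values. *)
rewrite {1}eqk => /cp_le_factor; rewrite sz => -[|q [leq1 leq2 eqq]]; first lia.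
rewrite offsetS /left_move.
case: (boolP (monotone _)) => [mon|_] /=.
  split; last lia; have/eqP := mon.
  rewrite monotone_factor; last exact/oneline_uniq/chain_oneline/ltnW.
  rewrite {1 3}eqk (chain_nth_size (ltnW ltk)) -subnS.
  rewrite eqb_id !factor_factor; [|lia..] => /eqP eqf.
  rewrite -eqq; have [->|->] : q = offset tau C k \/ q = (offset tau C k).+1 by lia.
    by rewrite -eqf addn0.
  by rewrite addn1.
case: eqP => [<-|neq] /=; first by rewrite addn1; split=> //; lia.
split; last lia; rewrite -eqq; congr (factor _ _ _).
suff: q != (offset tau C k).+1 by lia.
by apply/eqP => eqq'; apply: neq; rewrite -eqq'.
Qed.

Lemma chain_left k : k.+1 < size C -> left_move tau C k ->
  nth [::] C k.+1 = factor tau (offset tau C k).+1 (size tau - k.+1).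
Proof. by move=> /chain_factor[-> _] lm; rewrite offsetS lm addn1. Qed.

Lemma chain_right k : k.+1 < size C -> ~~ left_move tau C k ->
  nth [::] C k.+1 = factor tau (offset tau C k) (size tau - k.+1).
Proof. by move=> /chain_factor[-> _] /negPf lm; rewrite offsetS lm addn0. Qed.

Lemma chain_idE : chain_id C = [seq move_label tau C k | k <- iota 0 (size C).-1].
Proof.
have := chain_labelsE (k := 0) (add0n _) chain_size_le chain_gt0.
rewrite drop1 chain_head add0n subn0 => <-.
by case: maxC; case: C => //= t r _ ->.
Qed.

Lemma size_chain_id : size (chain_id C) = (size C).-1.
Proof. by rewrite chain_idE size_map size_iota. Qed.

(** Labels are numbered from 1 and moves from 0: [l_(k+1)] belongs to the move out of [rho_k]. *)
Lemma labelE k : k.+1 < size C -> label C k.+1 = move_label tau C k.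
Proof.
move=> ltk; rewrite /label chain_idE (nth_map 0) ?nth_iota ?size_iota //; lia.
Qed.

Lemma chain_uniq_index k m : k < size C -> m < size C ->
  (nth [::] C k == nth [::] C m) = (k == m).
Proof.
move=> ltk ltm; apply/eqP/eqP => [eqkm|-> //].
by have := chain_size_nth ltk; have := chain_size_nth ltm; rewrite eqkm; lia.
Qed.

Lemma mem_chain_interval i j k : j <= size C -> k < size C ->
  (nth [::] C k \in chain_interval C i j) = (i < k < j).
Proof.
move=> lej ltk; apply/mapP/idP => [[m]|ltkj].
  rewrite mem_iota => ltm /eqP; rewrite chain_uniq_index //; lia.
by exists k => //; rewrite mem_iota; lia.
Qed.

End Chain.

(** * Lexicographic comparison and detours *)

(** From a common window the two different covers are the two end deletions. The window has at least
    two letters, so the left label is the smaller one. *)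
Lemma chain_lex_lt_first_diff sigma tau C C' k :
  maximal_chain sigma tau C -> maximal_chain sigma tau C' ->
  k.+1 < size C -> (forall m, m <= k -> nth [::] C m = nth [::] C' m) ->
  nth [::] C k.+1 <> nth [::] C' k.+1 ->
  (left_move tau C' k = ~~ left_move tau C k)
  * (chain_lex_lt C' C = ~~ left_move tau C k).
Proof.
move=> mC mC' ltk eqC neq.
have eqo : offset tau C k = offset tau C' k by apply: offset_eq.
have ltk' : k.+1 < size C' by rewrite (chain_size mC') -(chain_size mC).
have opp : left_move tau C' k = ~~ left_move tau C k.
  case: (boolP (left_move tau C k)) => lm; case: (boolP (left_move tau C' k)) => lm' //.
    by case: neq; rewrite (chain_left mC) // (chain_left mC') // eqo.
  by case: neq; rewrite (chain_right mC) // (chain_right mC') // eqo.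
split=> //; rewrite /chain_lex_lt.
have lblE D (mD : maximal_chain sigma tau D) (ltD : k.+1 < size D) :
    nth 0 (chain_id D) k = move_label tau D k by exact: (labelE mD ltD).
have ltN := chain_index_lt mC ltk.
rewrite (@seqlexi_lt_nth _ _ k) ?(size_chain_id mC) ?(size_chain_id mC'); try lia.
- rewrite !lblE // /move_label opp eqo; case: (left_move tau C k) => /=; lia.
- rewrite (chain_idE mC) (chain_idE mC') -!map_take !take_iota.
  have -> : minn k (size C).-1 = k by lia.
  have -> : minn k (size C').-1 = k by lia.
  apply/eq_in_map => m; rewrite mem_iota => /andP[_ ltm].
  have eqm : offset tau C' m = offset tau C m.
    by apply/esym/offset_eq => l lel; apply: eqC; lia.
  rewrite /move_label /left_move eqm -!eqC //; lia.
- rewrite !lblE // /move_label opp eqo; case: (left_move tau C k) => /=; lia.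
Qed.

(* [C] goes right at [rho_k] although [rho_j] also occurs after a left move. *)
Definition detour (tau : seq nat) (C : seq (seq nat)) (k j : nat) : Prop :=
  [/\ k.+1 < j, ~~ left_move tau C k
    & cp_le (nth [::] C j) (factor tau (offset tau C k).+1 (size tau - k.+1))].

Section Skipped.

Variables (sigma tau : seq nat) (C : seq (seq nat)).
Hypothesis maxC : maximal_chain sigma tau C.

(** An earlier chain first differs from [C] strictly inside the interval, by a left move where [C]
    goes right. It still contains [rho_j], which therefore occurs after that left move. *)
Lemma skipped_detour i j : skipped_interval sigma tau C i j ->
  exists2 k, i <= k & detour tau C k j.
Proof.
case=> /andP[ltij ltj] _ [C' [maxC' ltC' subC]].
have szC : size C' = size C by rewrite (chain_size maxC) (chain_size maxC').
(* The length of an element fixes its index, so a shared element has the same index in both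
   chains. *)
have eqC m : m < size C -> ~~ (i < m < j) -> nth [::] C m = nth [::] C' m.
  move=> ltm nin; have := subC (nth [::] C m).
  rewrite mem_nth // (mem_chain_interval maxC) ?(ltnW ltj) // => /(_ isT nin).
  case/(nthP [::]) => l; rewrite szC => ltl eql.
  have := chain_size_nth maxC ltm; rewrite -{1}eql.
  have := @chain_size_nth _ _ _ maxC' l; rewrite szC => /(_ ltl) sz1 sz2.
  by rewrite -eql; congr nth; apply: (@addnI (size (nth [::] C' l))); rewrite sz1.
have exm : exists m, (m < size C) && (nth [::] C m != nth [::] C' m).
  case: (boolP [exists m : 'I_(size C), nth [::] C m != nth [::] C' m]).
    by case/existsP=> m neq; exists m; rewrite ltn_ord.
  rewrite negb_exists => /forallP allm.
  suff eqCC : C = C' by move: ltC'; rewrite /chain_lex_lt eqCC Order.POrderTheory.ltxx.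
  apply: (@eq_from_nth _ [::]) => // m ltm.
  by apply/eqP; have := allm (Ordinal ltm); rewrite negbK.
case: (ex_minnP exm) => [[|k]] /andP[ltk /eqP neq] mink.
  by case: neq; apply: eqC => //; lia.
have ltikj : i < k.+1 < j by apply: contra_notT neq => nin; apply: eqC.
have eqk m : m <= k -> nth [::] C m = nth [::] C' m.
  move=> lem; apply/eqP; apply: contraT => neqm.
  by have := mink m; rewrite neqm; lia.
have [opp lexE] := chain_lex_lt_first_diff maxC maxC' ltk eqk neq.
have nleft : ~~ left_move tau C k by rewrite -lexE.
exists k; first lia.
split=> //; first lia.
rewrite eqC //; last lia.
rewrite (offset_eq tau eqk) -(chain_left maxC') ?opp ?szC //.
by apply: chain_le maxC' _ _ _ _; rewrite ?szC //; lia.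
Qed.

Lemma detour_skipped i j k : i < j < size C -> i <= k -> detour tau C k j ->
  skipped_interval sigma tau C i j.
Proof.
move=> /andP[ltij ltj] leik [ltkj nleft].
have ltN := chain_index_lt maxC ltj.
have ltk : k < size C by lia.
have [eqk lek] := chain_factor maxC ltk.
case/cp_le_factor => [|q]; first lia.
rewrite (chain_nth_size maxC ltj) => -[leq1 leq2 eqq].
(* The window of the bypass moves right to the occurrence [q] of [rho_j] first, then loses
   its right end; the convention for monotone patterns only affects later labels. *)
pose D m := if k < m <= j then factor tau (minn q (offset tau C k + (m - k))) (size tau - m)
            else nth [::] C m.
pose C' := mkseq D (size C).
have C0 := chain_gt0 maxC.
have nthC' m : m < size C -> nth [::] C' m = D m by move=> ltm; rewrite nth_mkseq.
(* This formula also covers [m = k], and the next one also covers [m = j], where the bypass has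
   reached [q]. Each cover can thus be checked with a single description. *)
have DE m : k <= m <= j ->
    D m = factor tau (minn q (offset tau C k + (m - k))) (size tau - m).
  move=> lem; rewrite /D; case: ifP => // nin.
  have -> : m = k by lia.
  by rewrite eqk; congr (factor _ _ _); lia.
have DnE m : ~~ (k < m < j) -> D m = nth [::] C m.
  move=> nin; rewrite /D; case: ifP => // lem.
  have -> : m = j by lia.
  by rewrite -[RHS]eqq; congr (factor _ _ _); lia.
have utau := oneline_uniq (chain_top_oneline maxC).
have oneD m : m < size C -> oneline (D m).
  move=> ltm; have := chain_index_lt maxC ltm => ltmN.
  case: (boolP (k < m < j)) => [lem|nin]; last by rewrite DnE //; apply: (chain_oneline maxC).
  by rewrite DE; [apply: oneline_factor => //; lia | lia].
have maxC' : maximal_chain sigma tau C'.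
  split.
  - by rewrite size_mkseq.
  - by rewrite -nth0 nthC' // DnE ?(chain_head maxC) //; lia.
  - rewrite -nth_last size_mkseq nthC' ?DnE ?(chain_last maxC) //; lia.
  - by apply/(all_nthP [::]) => m; rewrite size_mkseq => ltm; rewrite nthC' // oneD.
  move=> m; rewrite size_mkseq => ltm; rewrite !nthC' //; last lia.
  have ltmN := chain_index_lt maxC ltm.
  case: (boolP (k <= m < j)) => [lem|nin]; last first.
    by rewrite !DnE; [case: maxC => _ _ _ _; apply | lia..].
  apply: cp_coverI; [exact: oneD | by apply: oneD; lia | | ].
    rewrite !DE; try lia; apply: cp_le_factorI; lia.
  rewrite !DE; try lia; rewrite !size_factor; lia.
split=> //; first lia.
  apply/eqP; rewrite -size_eq0 size_map size_iota; lia.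
exists C'; split=> //.
  have [|||_ ->] := @chain_lex_lt_first_diff _ _ _ _ k maxC maxC'; try lia.
  - by move=> m lem; rewrite nthC' ?DnE //; lia.
  - rewrite nthC' ?DE; try lia.
    have -> : minn q (offset tau C k + (k.+1 - k)) = (offset tau C k).+1 by lia.
    move=> eqk1; move: nleft; rewrite /left_move eqk1 eqxx orbT //.
move=> r /(nthP [::])[m ltm <-].
rewrite (mem_chain_interval maxC) ?(ltnW ltj) // => nin.
by rewrite -(DnE m) -?nthC' ?mem_nth ?size_mkseq //; lia.
Qed.

(** By the two preceding lemmas an interval is skipped exactly when some detour with the same lower
    end starts at or after [i], so minimality passes to detours. *)
Lemma minimal_skippedP i j : i < j < size C ->
  minimal_skipped_interval sigma tau C i j <->
  detour tau C i j /\
  (forall i' j', i <= i' -> j' <= j -> detour tau C i' j' -> i' = i /\ j' = j).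
Proof.
move=> ltij; have lej : j <= size C by lia.
(* A nonempty interval is determined by its extreme elements, at indices [i1 + 1] and [j1 - 1]. *)
have subE i1 j1 i2 j2 : i1.+1 < j1 <= size C -> j2 <= size C ->
    {subset chain_interval C i1 j1 <= chain_interval C i2 j2} <-> i2 <= i1 /\ j1 <= j2.
  move=> lt1 lt2; split=> [sub|[lei lej'] r].
    have := sub (nth [::] C i1.+1); have := sub (nth [::] C j1.-1).
    rewrite !(mem_chain_interval maxC); try lia.
  case/mapP=> m; rewrite mem_iota => lem ->.
  by rewrite (mem_chain_interval maxC) //; lia.
split=> [[skip minS]|[det minD]].
  have key i' j' : i <= i' -> j' <= j -> detour tau C i' j' -> i' = i /\ j' = j.
    move=> lei lej' det; have [lt' _ _] := det.
    have skip' : skipped_interval sigma tau C i' j'.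
      by apply: detour_skipped det => //; lia.
    have eqI := minS _ _ skip' (proj2 (subE _ _ _ _ _ _) (conj lei lej')).
    have [] : i' <= i /\ j <= j'; last by lia.
    apply: (proj1 (subE i j i' j' _ _)); try lia.
    move=> r rin; rewrite eqI ?rin //; lia.
  have [k leik det] := skipped_detour skip.
  by have [eqk _] := key _ _ leik (leqnn j) det; rewrite -{1}eqk.
have [lt _ _] := det.
split; first exact: detour_skipped det.
move=> i' j' skip' sub; have [k lek detk] := skipped_detour skip'.
have [ltk _ _] := detk; case: skip' => ltij' _ _.
have [lei lej'] : i <= i' /\ j' <= j by apply: (proj1 (subE i' j' i j _ _)) sub; lia.
have [eqk ->] := minD k j' (leq_trans lei lek) lej' detk.
by have -> : i' = i by lia.
Qed.

End Skipped.

(** * Interior and exterior as factors *)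

Lemma interior_factor r : 1 < size r -> interior r = factor r 1 (size r - 2).
Proof.
move=> lt; rewrite /interior -drop1 /factor take_drop; congr (std (drop _ (take _ _))); lia.
Qed.

Lemma perm_prefix_factor k r : perm_prefix k r = factor r 0 k.
Proof. by rewrite /perm_prefix /factor drop0. Qed.

Lemma perm_suffix_factor k r : k <= size r -> perm_suffix k r = factor r (size r - k) k.
Proof.
by move=> le; rewrite /perm_suffix /factor take_oversize // size_drop; lia.
Qed.

(** All one-letter words have the same standard form, so length 1 is a candidate and the maximum is
    attained. *)
Lemma exteriorP r : 1 < size r -> exists k,
  [/\ 0 < k < size r, factor r 0 k = factor r (size r - k) k, exterior r = factor r 0 k
    & forall l, l < size r -> factor r 0 l = factor r (size r - l) l -> l <= k].
Proof.
move=> lt; pose P (k : 'I_(size r)) := perm_prefix k r == perm_suffix k r.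
have PE l (ltl : l < size r) : P (Ordinal ltl) = (factor r 0 l == factor r (size r - l) l).
  by rewrite /P perm_prefix_factor perm_suffix_factor // ltnW.
have P1 : P (Ordinal lt).
  rewrite PE; apply/eqP/eq_std => [|a b]; rewrite !size_take_drop; try lia.
  by case: a b => [|//] [|//] _ _; rewrite !leqnn.
have cardP : 0 < #|P| by apply/card_gt0P; exists (Ordinal lt).
have [[k ltk] Pk maxk] := eq_bigmax_cond (fun k : 'I_(size r) => k : nat) cardP.
have maxP l (ltl : l < size r) : factor r 0 l = factor r (size r - l) l -> l <= k.
  move=> eql; rewrite -[k]/(nat_of_ord (Ordinal ltk)) -maxk.
  have Pl : P (Ordinal ltl) by rewrite PE eql.
  exact: (@leq_bigmax_cond _ P (fun k : 'I_(size r) => k : nat) _ Pl).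
exists k; split=> //.
- rewrite ltk andbT; apply: (maxP 1 lt); apply/eqP; rewrite -PE; exact: P1.
- by apply/eqP; rewrite -PE.
by rewrite /exterior -perm_prefix_factor; congr perm_prefix; exact: maxk.
Qed.

(** * Consecutive moves and their labels *)

Section Moves.

Variables (sigma tau : seq nat) (C : seq (seq nat)).
Hypothesis maxC : maximal_chain sigma tau C.

(** Deleting the same two end letters in the opposite order starts with a left move and reaches the
    same window. *)
Lemma detour_right_left k : k.+2 < size C ->
  ~~ left_move tau C k -> left_move tau C k.+1 -> detour tau C k k.+2.
Proof.
move=> ltk nleft left1; split=> //; have ltN := chain_index_lt maxC ltk.
have lek := (chain_factor maxC (ltnW (ltnW ltk))).2.
rewrite (chain_left maxC ltk left1) offsetS (negPf nleft) addn0.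
by apply: cp_le_factorI; lia.
Qed.

(** Two right moves lower the label by exactly one, and after a left move the label rises; only
    right then left drops it further. *)
Lemma strong_descentE k : k.+2 < size C ->
  strong_descent C k.+1 = ~~ left_move tau C k && left_move tau C k.+1.
Proof.
move=> ltk; have ltN := chain_index_lt maxC ltk.
rewrite /strong_descent (size_chain_id maxC) !(labelE maxC); try lia.
rewrite /move_label offsetS.
by case: (left_move tau C k); case: (left_move tau C k.+1); lia.
Qed.

Lemma labels_decreasingP i j : j < size C ->
  reflect (i.+1 < j /\ forall k, i <= k -> k.+1 < j ->
             move_label tau C k.+1 < move_label tau C k)
          (labels_decreasing C i j).
Proof.
move=> ltj; apply: (iffP andP) => [[lt /(sortedP 0) dec]|[lt dec]]; split=> //.
  move=> k leik ltk; have := dec (k - i); rewrite size_map size_iota.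
  rewrite !(nth_map 0) ?size_iota ?nth_iota; try lia.
  have -> : i.+1 + (k - i).+1 = k.+2 by lia.
  have -> : i.+1 + (k - i) = k.+1 by lia.
  by rewrite /= !(labelE maxC); try lia; apply; lia.
apply/(sortedP 0) => l; rewrite size_map size_iota => ltl.
rewrite !(nth_map 0) ?size_iota ?nth_iota; try lia.
rewrite !addSn addnS !(labelE maxC) /=; try lia.
by apply: dec; lia.
Qed.

Lemma offset_right i k : i <= k ->
  (forall m, i <= m < k -> ~~ left_move tau C m) ->
  offset tau C k = offset tau C i.
Proof.
elim: k => [|k IHk]; first by rewrite leqn0 => /eqP->.
rewrite leq_eqVlt => /orP[/eqP-> //|leik] right.
rewrite offsetS (negPf (right k _)) ?addn0; last lia.
by apply: IHk => // m lem; apply: right; lia.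
Qed.

Lemma interior_chain i : i.+1 < size C ->
  interior (nth [::] C i) = factor tau (offset tau C i).+1 (size tau - i.+2).
Proof.
move=> lti; have ltN := chain_index_lt maxC lti.
have [eqi lei] := chain_factor maxC (ltnW lti).
have sz := chain_nth_size maxC (ltnW lti).
rewrite interior_factor sz; last lia.
rewrite eqi factor_factor; try lia.
by rewrite addn1; congr factor; lia.
Qed.

(** If both deletions gave the same pattern, the test in [left_move] would succeed. *)
Lemma right_factor_neq k : k.+1 < size C -> ~~ left_move tau C k ->
  factor tau (offset tau C k) (size tau - k.+1)
    <> factor tau (offset tau C k).+1 (size tau - k.+1).
Proof.
move=> ltk nleft eqf; move: (nleft).
by rewrite /left_move -eqf (chain_right maxC) ?eqxx ?orbT.
Qed.

End Moves.

(** * Characterization of minimal skipped intervals *)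

Theorem theorem2p6 (sigma tau : seq nat) (C : seq (seq nat)) (i j : nat)
    (hsigma : oneline sigma) (htau : oneline tau) (hle : cp_le sigma tau)
    (hC : maximal_chain sigma tau C)
    (hij : i < j) (hj : j <= size tau - size sigma) :
  minimal_skipped_interval sigma tau C i j <->
  (j = i.+2 /\ strong_descent C i.+1) \/
  [/\ nth [::] C j = exterior (nth [::] C i),
      ~ cp_le (exterior (nth [::] C i)) (interior (nth [::] C i))
    & labels_decreasing C i j].
Proof.
have ltj : j < size C by rewrite (chain_size hC) ltnS.
have ltjN := chain_index_lt hC ltj.
have lti : i < size C by lia.
have [eqi lei] := chain_factor hC lti.
have szi := chain_nth_size hC lti.
have szj := chain_nth_size hC ltj.
have subf q l : q + l <= size tau - i ->
    factor (nth [::] C i) q l = factor tau (offset tau C i + q) l.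
  by move=> le; rewrite eqi factor_factor //; lia.
(* From here on [k] is the length of [x(rho_i)], and its prefix and suffix copies are read as
   factors of [tau]. *)
have := @exteriorP (nth [::] C i); rewrite szi => -[|k]; first lia.
case=> /andP[k0 ltk]; rewrite !subf ?addn0; try lia.
move=> eqpre extE maxk.
rewrite (interior_chain hC); last lia.
rewrite minimal_skippedP ?hij //.
split.
  case=> -[ltij nlefti lejf] minD.
  (* A right move followed by a left move is itself a detour; minimality makes it the whole
     interval, which is case (a). *)
  case: (boolP (has (fun m => ~~ left_move tau C m && left_move tau C m.+1) (iota i (j - i.+1)))).
    case/hasP=> m; rewrite mem_iota => lem /andP[nleft left1].
    have [|||eqm eqj] := minD m m.+2; try lia.
      by apply: (detour_right_left hC) => //; lia.
    left; split; first lia.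
    by rewrite (strong_descentE hC) -?eqm ?nleft //; lia.
  move/hasPn => noRL; right.
  have right m : i <= m < j -> ~~ left_move tau C m.
    elim: m => [|m IHm] lem; first by have <- : i = 0 by lia.
    case: (eqVneq i m.+1) => [<- //|neq].
    have := noRL m; rewrite mem_iota IHm /=; last lia.
    by apply; lia.
  have offE m : i <= m <= j -> offset tau C m = offset tau C i.
    by move=> lem; apply: offset_right => [|l lel]; [|apply: right]; lia.
  have facE m : i <= m <= j -> nth [::] C m = factor tau (offset tau C i) (size tau - m).
    by move=> lem; rewrite (chain_factor hC _).1 ?offE //; lia.
  (* If [rho_j] occurred in the interior, [(i+1, j)] would be a smaller detour. For [j = i+2] both
     deletions of [rho_(i+1)] would agree, against its right move. *)
  have noint : ~ cp_le (nth [::] C j) (factor tau (offset tau C i).+1 (size tau - i.+2)).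
    move=> lej; case: (ltnP i.+2 j) => [ltj2|lej2].
      have [|||eqm eqm'] := minD i.+1 j; try lia.
      by split; [lia | apply: right; lia | rewrite offE //; lia].
    have eqj : j = i.+2 by lia.
    have ltk1 : i.+2 < size C by lia.
    have := right_factor_neq hC ltk1 (right i.+1 _); rewrite offE; try lia.
    move=> neq; apply: neq; first lia.
    rewrite -facE; last lia.
    rewrite -eqj; apply: cp_le_eq; rewrite eqj in lej szj *.
    - by apply: oneline_factor; [exact: oneline_uniq | lia..].
    - by rewrite szj size_factor //; lia.
    - exact: lej.
  have [q [leq1 leq2 eqq]] : exists q, [/\ (offset tau C i).+1 <= q,
      q + size (nth [::] C j) <= (offset tau C i).+1 + (size tau - i.+1)
      & factor tau q (size (nth [::] C j)) = nth [::] C j].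
    by apply/cp_le_factor => //; lia.
  rewrite szj in leq2 eqq.
  (* Any occurrence after the left deletion other than the suffix would lie in the interior. *)
  have eqsuf : nth [::] C j = factor tau (offset tau C i + (j - i)) (size tau - j).
    case: (eqVneq q (offset tau C i + (j - i))) => [<- //|neqq].
    case: noint; apply/cp_le_factor; first lia.
    by exists q; rewrite szj; split=> //; lia.
  have lejk : size tau - j <= k.
    apply: maxk; rewrite ?subf ?addn0; try lia.
    by rewrite -facE ?eqsuf; [congr factor; lia | lia].
  have eqk : k = size tau - j.
    (* With right moves only, a longer exterior is the chain element of index [size tau - k], giving
       a shorter detour. At index [i+1] both deletions of [rho_i] would agree. *)
    apply/eqP; rewrite eqn_leq lejk andbT leqNgt; apply/negP => ltjk.
    have lej' : i < size tau - k < j by lia.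
    have subK : size tau - (size tau - k) = k by lia.
    have facj : nth [::] C (size tau - k) = factor tau (offset tau C i) k.
      by rewrite facE ?subK //; lia.
    case: (eqVneq (size tau - k) i.+1) => [eqi1|neqi1].
      have lti1 : i.+1 < size C by lia.
      have := right_factor_neq hC lti1 nlefti; apply; rewrite -eqi1 subK eqpre.
      by congr factor; lia.
    have [|||eqm eqm'] := minD i (size tau - k); try lia.
    split; [lia | exact: nlefti | rewrite facj eqpre].
    by apply: cp_le_factorI; lia.
  have extj : exterior (nth [::] C i) = nth [::] C j.
    by rewrite extE eqk facE //; lia.
  split; rewrite ?extj //.
  apply/(labels_decreasingP hC) => //; split=> // m leim ltm.
  rewrite /move_label !(negPf (right _ _)) ?offE; lia.
case=> [[eqj]|[eqext noint /(labels_decreasingP hC) dec]].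
  rewrite eqj in ltj *; rewrite (strong_descentE hC) // => /andP[nleft left1].
  split; first exact: (detour_right_left hC).
  by move=> i' j' lei' lej' [lt' _ _]; lia.
have {dec}[//|ltij dec] := dec.
rewrite -eqext in noint.
(* After a left move the next label is larger whichever end is deleted. The bound stops before the
   last move, which has no next label in the sequence. *)
have right m : i <= m -> m.+1 < j -> ~~ left_move tau C m.
  move=> leim ltm; apply/negP => leftm; have := dec m leim ltm.
  have ltmN : m.+1 < size tau by lia.
  rewrite /move_label offsetS leftm.
  by case: (left_move tau C m.+1); lia.
have offE m : i <= m < j -> offset tau C m = offset tau C i.
  by move=> lem; apply: offset_right => [|l lel]; [|apply: right]; lia.
have eqkj : k = size tau - j.
  by have := congr1 size eqext; rewrite szj extE size_factor //; lia.
(* That [rho_j] is a prefix of [rho_i] comes from its being the exterior, not from the kind of the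
   last move. *)
have facj : nth [::] C j = factor tau (offset tau C i) (size tau - j).
  by rewrite eqext extE eqkj.
have leC (q l : nat) : (offset tau C i).+1 <= q ->
    q + (size tau - j) <= offset tau C i + (size tau - i.+1) ->
    factor tau q (size tau - j) <> nth [::] C j.
  move=> leq1 leq2 eqq; apply: noint; apply/cp_le_factor; first lia.
  by exists q; rewrite szj; split=> //; lia.
split.
  split=> //; first exact: right.
  (* The suffix copy of the exterior survives the deletion of the first letter. *)
  by rewrite eqext extE eqpre; apply: cp_le_factorI; lia.
move=> i' j' lei' lej' [lt' nleft'].
have ltj' : j' < size C by lia.
have ltjN' := chain_index_lt hC ltj'.
rewrite offE; last lia.
move=> le'.
have eqi' : i' = i.
  (* For [i' > i] the window has also lost its last letter, so [rho_j], contained in [rho_j'], would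
     occur in the interior of [rho_i]. *)
  apply/eqP; rewrite eqn_leq lei' andbT leqNgt; apply/negP => lti'.
  apply: noint; apply: cp_le_trans (chain_le hC lej' ltj) _.
  apply: cp_le_trans le' _.
  by apply: cp_le_factorI; lia.
(* For [j' < j] the prefix [rho_j] of the displaced copy of [rho_j'] ends before the last letter of
   [rho_i], again inside the interior. *)
split=> //; apply/eqP; rewrite eqn_leq lej' leqNgt; apply/negP => ltjj.
move: le'; rewrite eqi' => /cp_le_factor[|q]; first lia.
rewrite (chain_nth_size hC ltj') (chain_factor hC ltj').1 offE => [[leq1 leq2 eqq]|]; last lia.
apply: (leC q) => //; first lia.
rewrite facj -[q]addn0 -[offset tau C i]addn0.
rewrite -(@factor_factor _ q (size tau - j')); try lia.
by rewrite -(@factor_factor _ (offset tau C i) (size tau - j')) ?eqq //; lia.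
Qed.
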